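(* Let $m\ge 1$, let $f_1,\dots,f_m:\mathbb{R}^d\to\mathbb{R}$ be twice continuously differentiable, and let $F(x)=\frac1m\sum_{k=1}^m f_k(x)$. Assume $F$ is convex, has a minimizer $x_F^*$, and has $L$-Lipschitz Hessian: $\|\nabla^2F(x)-\nabla^2F(y)\|\le L\|x-y\|$ for all $x,y$. Assume the statistical similarity condition: for some $\beta>0$ and every $k=1,\dots,m$, $\|\nabla^2F(x)-\nabla^2 f_k(x)\|\le\beta$ for all $x\in\mathbb{R}^d$. Let $\{x_t\}_{t\ge1}$ be generated by the Accelerated Cubic Newton method (Algorithm 1, described in the context) started from $x_0\in\mathbb{R}^d$. Then for every $t\ge1$, $$F(x_t)-F(x_F^* )\le \frac{98L\|x_0-x_F^*\|^3}{t^3}+\frac{48\beta\|x_0-x_F^*\|^2}{t^2}.$$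
   Context: Norms are Euclidean (operator norm for matrices). For $M>0$ and $x,z\in\mathbb{R}^d$ define the model $$\widetilde F_M(x,z)=F(z)+\langle\nabla F(z),x-z\rangle+\tfrac12\langle(\nabla^2 f_1(z)+3\beta I)(x-z),x-z\rangle+\tfrac M6\|x-z\|^3.$$ Algorithm 1 (Accelerated Cubic Newton), input $x_0$, $A_0=1$, $L$, $\beta$: Step 0: $x_1=\arg\min_x \widetilde F_{4L}(x,x_0)$; $\psi_1(x):=F(x_1)+8\beta\|x-x_0\|^2+16L\|x-x_0\|^3$; $y_1=\arg\min_x\psi_1(x)$; set $w_0=x_0$, $t=1$. Step 1: $w_t=\left(1-\frac{3}{t+3}\right)x_t+\frac{3}{t+3}y_t$, and $x_{t+1}=\arg\min_x\widetilde F_{4L}(x,w_t)$. Step 2: $A_t=A_{t-1}\left(1-\frac{3}{t+3}\right)$, $$\psi_{t+1}(x)=\psi_t(x)+4\beta\|x-x_0\|^2+\frac{3}{A_t(t+3)}\Big(F(x_{t+1})+\langle\nabla F(x_{t+1}),x-x_{t+1}\rangle\Big),$$ and $y_{t+1}=\arg\min_x\psi_{t+1}(x)$. Step 3: $t\leftarrow t+1$, go to Step 1. (In the distributed interpretation, $f_1$ is held by a master node and each iteration uses two communication rounds to aggregate gradients $\nabla F$.) *)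

(* Defs.v *)
From HB Require Import structures.
From mathcomp Require Import all_boot all_order all_algebra.
From mathcomp Require Import all_classical all_reals all_analysis.
Set Implicit Arguments. Unset Strict Implicit. Unset Printing Implicit Defensive.
Import Order.TTheory GRing.Theory Num.Theory.
Import numFieldNormedType.Exports.
Local Open Scope classical_set_scope.
Local Open Scope ring_scope.

Section Defs.
Variables (R : realType) (d : nat).
Notation vec := 'rV[R]_d.
Notation mat := 'M[R]_d.

Definition dotp (u v : vec) : R := \sum_(i < d) u 0 i * v 0 i.
Definition enorm (v : vec) : R := Num.sqrt (dotp v v).

Definition mxv (A : mat) (v : vec) : vec := (A *m v^T)^T.

Definition opnorm (A : mat) : R :=
  sup [set enorm (mxv A v) | v in [set v : vec | enorm v <= 1]].

Definition is_argmin (phi : vec -> R) (x : vec) : Prop :=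
  forall z, phi x <= phi z.

Definition convex_fun (phi : vec -> R) : Prop :=
  forall (x y : vec) (s : R), 0 <= s <= 1 ->
    phi (s *: x + (1 - s) *: y) <= s * phi x + (1 - s) * phi y.

(* The cubic model  F~_M(x,z) ; FF, gF are F and its gradient, H1 is the Hessian of f_1 *)
Definition cubic_model (FF : vec -> R) (gF : vec -> vec) (H1 : vec -> mat)
    (beta M : R) (z x : vec) : R :=
  FF z + dotp (gF z) (x - z)
  + 2^-1 * dotp (mxv (H1 z + (3 * beta)%:M) (x - z)) (x - z)
  + M / 6 * enorm (x - z) ^+ 3.

Fixpoint Aseq (t : nat) : R :=
  match t with
  | 0 => 1
  | t'.+1 => Aseq t' * (1 - 3 / (t'.+1%:R + 3))
  end.

(* psi_seq FF gF L beta x0 xs n  =  psi_{n+1} of Algorithm 1 *)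
Fixpoint psi_seq (FF : vec -> R) (gF : vec -> vec) (L beta : R) (x0 : vec)
    (xs : nat -> vec) (n : nat) : vec -> R :=
  match n with
  | 0 => fun x => FF (xs 1%N) + 8 * beta * enorm (x - x0) ^+ 2
                  + 16 * L * enorm (x - x0) ^+ 3
  | n'.+1 => fun x =>
      psi_seq FF gF L beta x0 xs n' x + 4 * beta * enorm (x - x0) ^+ 2
      + 3 / (Aseq n'.+1 * (n'.+1%:R + 3))
        * (FF (xs n'.+2) + dotp (gF (xs n'.+2)) (x - xs n'.+2))
  end.

End Defs.

(* Main.v *)
Require Import Defs.
From HB Require Import structures.
From mathcomp Require Import all_boot all_order all_algebra.
From mathcomp Require Import all_classical all_reals all_analysis.
From mathcomp Require Import ring lra.
Set Implicit Arguments. Unset Strict Implicit. Unset Printing Implicit Defensive.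
Import Order.TTheory GRing.Theory Num.Theory.
Import numFieldNormedType.Exports.
Local Open Scope classical_set_scope.
Local Open Scope ring_scope.

(* Estimate sequence: psi_t is a sum of linear lower bounds of F plus a
   quadratic-cubic prox term, so psi_t(z) exceeds min psi_t by
   4 beta (t+1) |z - y_t|^2 + 8 L |z - y_t|^3.  Optimality of the cubic step from w
   with h = x+ - w and r = |h| says that grad F(x+) + (3 beta + 2 L r) h has norm at
   most beta r + L r^2 / 2; this needs a symmetric Hessian, because the model only
   sees the symmetric part of the Hessian of f_1.  Expanding the square gives the
   decrease of <grad F(x+), w - x+> that pays for the momentum term, whence
   F(x_t) / A_(t-1) <= min psi_t <= psi_t(xstar).

   For the constant 98 = 6 (16 + 1/3), the crude estimate F(x_1) <= min of the model
   (which gives 5/6 L D^3) is too weak.  With p = x_1 - xstar, D = |x_0 - xstar| and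
   X = <grad F(x_1), p>, the step inequality bounds X by a cubic in |p|, r, D;
   combining F(x_1) - F* <= X for large |p| with the midpoint bound
   F(x_1) - F* <= 3/4 X + L |p|^3 / 16 for small |p| yields
   L D^3 / 3 + 3/2 beta D^2. *)

(** * Euclidean inner product, norm and operator norm on row vectors *)

Section Euclidean.
Variables (R : realType) (d : nat).
Implicit Types (u v w : 'rV[R]_d) (A B : 'M[R]_d) (s : R).

Lemma dotpC u v : dotp u v = dotp v u.
Proof. by apply: eq_bigr => i _; rewrite mulrC. Qed.

Lemma dotpDl u v w : dotp (u + v) w = dotp u w + dotp v w.
Proof. by rewrite /dotp -big_split; apply: eq_bigr => i _; rewrite mxE mulrDl. Qed.

Lemma dotpZl s u w : dotp (s *: u) w = s * dotp u w.
Proof. by rewrite /dotp mulr_sumr; apply: eq_bigr => i _; rewrite mxE mulrA. Qed.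

Lemma dotpNl u w : dotp (- u) w = - dotp u w.
Proof. by rewrite -scaleN1r dotpZl mulN1r. Qed.

Lemma dotpDr u v w : dotp w (u + v) = dotp w u + dotp w v.
Proof. by rewrite dotpC dotpDl !(dotpC w). Qed.

Lemma dotpZr s u w : dotp w (s *: u) = s * dotp w u.
Proof. by rewrite dotpC dotpZl dotpC. Qed.

Lemma dotpNr u w : dotp w (- u) = - dotp w u.
Proof. by rewrite dotpC dotpNl dotpC. Qed.

Lemma mxvDr A u v : mxv A (u + v) = mxv A u + mxv A v.
Proof. by rewrite /mxv [(u + v)^T]raddfD mulmxDr raddfD. Qed.

Lemma mxvZr A s u : mxv A (s *: u) = s *: mxv A u.
Proof. by rewrite /mxv [(s *: u)^T]linearZ -scalemxAr linearZ. Qed.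

Lemma mxvNr A u : mxv A (- u) = - mxv A u.
Proof. by rewrite -scaleN1r mxvZr scaleN1r. Qed.

Lemma mxvDl A B u : mxv (A + B) u = mxv A u + mxv B u.
Proof. by rewrite /mxv mulmxDl raddfD. Qed.

Lemma mxvNl A u : mxv (- A) u = - mxv A u.
Proof. by rewrite /mxv mulNmx raddfN. Qed.

Lemma mxvZl s A u : mxv (s *: A) u = s *: mxv A u.
Proof. by rewrite /mxv -scalemxAl linearZ. Qed.

Lemma mxv_scalar s u : mxv s%:M u = s *: u.
Proof. by rewrite /mxv mul_scalar_mx -linearZ /= trmxK. Qed.

(** Expands an expression by bilinearity. Symmetry is left out, as it would loop; cross terms are
    aligned by [dotpC] where needed. *)
Definition dotpE := (mxvDr, mxvZr, mxvNr, mxvDl, mxvNl, mxvZl, mxv_scalar,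
  dotpDl, dotpZl, dotpNl, dotpDr, dotpZr, dotpNr).

Lemma dotp_ge0 u : 0 <= dotp u u.
Proof. by apply: sumr_ge0 => i _; rewrite -expr2 sqr_ge0. Qed.

Lemma enorm_ge0 u : 0 <= enorm u.
Proof. exact: sqrtr_ge0. Qed.

Lemma enorm_sqr u : enorm u ^+ 2 = dotp u u.
Proof. by rewrite sqr_sqrtr // dotp_ge0. Qed.

Lemma enormZ s u : enorm (s *: u) = `|s| * enorm u.
Proof.
by rewrite /enorm dotpZl dotpZr mulrA -expr2 sqrtrM ?sqr_ge0 // sqrtr_sqr.
Qed.

Lemma enormN u : enorm (- u) = enorm u.
Proof. by rewrite -scaleN1r enormZ normrN1 mul1r. Qed.

Lemma enormC u v : enorm (u - v) = enorm (v - u).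
Proof. by rewrite -enormN opprB. Qed.

Lemma enorm0 : enorm (0 : 'rV[R]_d) = 0.
Proof. by rewrite -(scale0r 0) enormZ normr0 mul0r. Qed.

Lemma enorm_eq0 u : enorm u = 0 -> u = 0.
Proof.
move=> u0; have : dotp u u = 0 by rewrite -enorm_sqr u0 expr0n.
move/psumr_eq0P => h; apply/rowP => i; rewrite mxE.
have /eqP := h (fun i _ => sqr_ge0 (u 0 i)) i isT.
by rewrite mulf_eq0 orbb => /eqP.
Qed.

Lemma dotp_le u v : dotp u v <= enorm u * enorm v.
Proof.
have [v0|v0] := eqVneq (enorm v) 0.
  rewrite v0 mulr0 (enorm_eq0 v0) -(scale0r 0) dotpZr mul0r //.
have [u0|u0] := eqVneq (enorm u) 0.
  by rewrite u0 mul0r (enorm_eq0 u0) -(scale0r 0) dotpZl mul0r.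
have up : 0 < enorm u by rewrite lt_neqAle eq_sym u0 enorm_ge0.
have vp : 0 < enorm v by rewrite lt_neqAle eq_sym v0 enorm_ge0.
have := dotp_ge0 (enorm v *: u - enorm u *: v).
rewrite !dotpE (dotpC v u) -!enorm_sqr => h.
have : 0 <= (enorm u * enorm v) * (enorm u * enorm v - dotp u v) by lra.
by rewrite pmulr_rge0 ?mulr_gt0 // subr_ge0.
Qed.

Lemma dotp_ge u v : - (enorm u * enorm v) <= dotp u v.
Proof. by rewrite lerNl -dotpNl -(enormN u) dotp_le. Qed.

Lemma enormD u v : enorm (u + v) <= enorm u + enorm v.
Proof.
rewrite -(@ler_pXn2r _ 2) ?nnegrE ?addr_ge0 ?enorm_ge0 //.
rewrite sqrrD !enorm_sqr !dotpE (dotpC v u).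
have := dotp_le u v; lra.
Qed.

Lemma enorm_le u (c : R) : 0 <= c -> (forall v, dotp u v <= c * enorm v) ->
  enorm u <= c.
Proof.
move=> c0 /(_ u); rewrite -enorm_sqr expr2.
have := enorm_ge0 u; rewrite le_eqVlt => /orP[/eqP <- //|up].
by rewrite ler_pM2r.
Qed.

(** Cauchy-Schwarz on each row. Some finite bound is needed before the [sup] in [opnorm] has its
    intended meaning. *)
Lemma mxv_bounded A : exists2 C : R, 0 <= C & forall v, enorm (mxv A v) <= C * enorm v.
Proof.
exists (\sum_i enorm (row i A)) => [|v]; first by apply: sumr_ge0 => i _; exact: enorm_ge0.
apply: enorm_le => [|w]; first by rewrite mulr_ge0 ?enorm_ge0 // sumr_ge0 // => i _; exact: enorm_ge0.
rewrite /dotp !mulr_suml; apply: ler_sum => i _.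
have -> : mxv A v 0 i = dotp (row i A) v.
  by rewrite !mxE; apply: eq_bigr => j _; rewrite !mxE.
have wi : `|w 0 i| <= enorm w.
  rewrite -sqrtr_sqr ler_sqrt ?dotp_ge0 // /dotp (bigD1 i) //= -expr2 lerDl.
  by apply: sumr_ge0 => j _; rewrite -expr2 sqr_ge0.
apply: le_trans (ler_norm _) _; rewrite normrM ler_pM //.
by rewrite ler_norml dotp_ge dotp_le.
Qed.

Lemma opnorm_has_sup A :
  has_sup [set enorm (mxv A v) | v in [set v : 'rV[R]_d | enorm v <= 1]].
Proof.
have [C C0 hC] := mxv_bounded A; split.
  by exists (enorm (mxv A 0)), 0 => //=; rewrite enorm0.
exists C => _ [v /= v1 <-]; apply: le_trans (hC v) _.
by rewrite ler_piMr.
Qed.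

Lemma opnorm_ge0 A : 0 <= opnorm A.
Proof.
apply: le_trans (enorm_ge0 (mxv A 0)) _.
by apply: sup_upper_bound; [exact: opnorm_has_sup | exists 0 => //=; rewrite enorm0].
Qed.

Lemma enorm_mxv A v : enorm (mxv A v) <= opnorm A * enorm v.
Proof.
have [v0|v0] := eqVneq (enorm v) 0.
  by rewrite (enorm_eq0 v0) -(scale0r 0) mxvZr !enormZ normr0 !mul0r mulr0.
have vp : 0 < enorm v by rewrite lt_neqAle eq_sym v0 enorm_ge0.
rewrite -ler_pdivrMr //.
have -> : enorm (mxv A v) / enorm v = enorm (mxv A ((enorm v)^-1 *: v)).
  by rewrite mxvZr enormZ ger0_norm ?invr_ge0 ?enorm_ge0 // mulrC.
apply: sup_upper_bound; first exact: opnorm_has_sup.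
by eexists; last reflexivity; rewrite /= enormZ ger0_norm ?invr_ge0 ?enorm_ge0 // mulVf.
Qed.

Lemma dotp_mxv_le A u v : dotp (mxv A u) v <= opnorm A * enorm u * enorm v.
Proof.
by apply: le_trans (dotp_le _ _) _; rewrite ler_wpM2r ?enorm_ge0 ?enorm_mxv.
Qed.

End Euclidean.

(** * Derivatives along lines and the mean value theorem on [0, 1] *)

Section LineDerivatives.
Variables (R : realType) (d : nat).
Implicit Types (a b : 'rV[R]_d) (s : R).

Lemma is_derive_line (W : normedModType R) (f : 'rV[R]_d -> W) (df : 'rV[R]_d -> W) a b s :
  is_diff (a + s *: b) f df ->
  is_derive s (1 : R) (fun s => f (a + s *: b)) (df b).
Proof.
move=> fD.
have lD : is_diff s (fun s : R => a + s *: b) ( *:%R^~ b).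
  by apply: (is_diff_eq (is_diffD _ _)); rewrite add0r.
have cD := @is_diff_comp _ _ _ _ _ _ _ _ s lD fD.
apply: DeriveDef; first by apply: diff_derivable; exact: ex_diff.
by rewrite deriveE ?diff_val //= ?scale1r //; exact: ex_diff.
Qed.

Lemma is_derive_dotp (g : R -> 'rV[R]_d) (dg v : 'rV[R]_d) s :
  is_derive s (1 : R) g dg -> is_derive s (1 : R) (fun s => dotp (g s) v) (dotp dg v).
Proof.
move=> gD.
have gd : derivable g s 1 by [].
have gi i : is_derive s (1 : R) (fun s => g s 0 i) (dg 0 i).
  apply: DeriveDef; first by move/derivable_mxP: gd; apply.
  by have [_ <-] := gD; rewrite derive_mx // mxE.
have -> : (fun s => dotp (g s) v) = \sum_(i < d) (v 0 i \*: (fun s => g s 0 i)).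
  by apply/funext => t; rewrite fct_sumE; apply: eq_bigr => i _; rewrite mulrC.
apply: is_derive_eq.
by apply: eq_bigr => i _; rewrite mulrC.
Qed.

Lemma MVT01 (phi dphi : R -> R) :
  (forall s, is_derive s (1 : R) phi (dphi s)) ->
  exists2 s, 0 <= s <= 1 & phi 1 - phi 0 = dphi s.
Proof.
move=> h.
have hc : {within `[0, 1], continuous phi}.
  by apply: derivable_within_continuous => s _; have [] := h s.
have [s + e] := MVT ltr01 (fun s _ => h s) hc.
rewrite in_itv /= => /andP[s0 s1]; exists s; first by rewrite !ltW.
by rewrite e subr0 mulr1.
Qed.

End LineDerivatives.

(** * Scalar limit arguments behind the first-order conditions *)

Lemma le0_small (R : realType) (l K : R) :
  (forall s, 0 < s <= 1 -> l <= s * K) -> l <= 0.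
Proof.
move=> h; apply/ler_addgt0Pl => e e0; rewrite addr0.
have K1 : 0 < 1 + `|K| by rewrite ltr_pwDl.
pose t := Num.min 1 (e / (1 + `|K|)).
have t0 : 0 < t by rewrite lt_min ltr01 divr_gt0.
have t1 : t <= 1 by rewrite ge_min lexx.
have tK : t * (1 + `|K|) <= e by rewrite -ler_pdivlMr // ge_min lexx orbT.
have := h t; rewrite t0 t1 => /(_ isT) ht.
apply: le_trans ht _; apply: le_trans tK; rewrite ler_wpM2l ?(ltW t0) //.
by apply: le_trans (ler_norm K) _; rewrite lerDr.
Qed.

(** Dividing by |s| and letting s tend to 0 from either side bounds l from both sides. This extracts
    every first-order condition at a minimizer below, and the symmetry of the Hessian. *)
Lemma linear_term_eq0 (R : realType) (l K : R) :
  (forall s, `|s| <= 1 -> 0 <= s * l + s ^+ 2 * K) -> l = 0.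
Proof.
move=> h; apply/eqP; rewrite eq_le -[X in _ && X]oppr_le0.
apply/andP; split; apply: (@le0_small _ _ K) => s /andP[s0 s1].
  have := h (- s); rewrite normrN ger0_norm ?(ltW s0) // => /(_ s1).
  rewrite sqrrN mulNr expr2 -mulrA -mulrN -mulrDr pmulr_rge0 //; lra.
have := h s; rewrite ger0_norm ?(ltW s0) // => /(_ s1).
rewrite expr2 -mulrA -mulrDr pmulr_rge0 //; lra.
Qed.

(** * Taylor bounds, Hessian symmetry and the tangent inequality for F *)

Section SmoothConvex.
Variables (R : realType) (d : nat).
Variables (F : 'rV[R]_d -> R) (gF : 'rV[R]_d -> 'rV[R]_d) (HF : 'rV[R]_d -> 'M[R]_d).
Variable L : R.
Hypothesis L_ge0 : 0 <= L.
Hypothesis F_derive : forall (a b : 'rV[R]_d) (s : R),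
  is_derive s (1 : R) (fun s => F (a + s *: b)) (dotp (gF (a + s *: b)) b).
Hypothesis gF_derive : forall (a b v : 'rV[R]_d) (s : R),
  is_derive s (1 : R) (fun s => dotp (gF (a + s *: b)) v)
    (dotp (mxv (HF (a + s *: b)) b) v).
Hypothesis HF_lip : forall a b, opnorm (HF a - HF b) <= L * enorm (a - b).

(** The terms subtracted in [phi] are chosen so that the Lipschitz Hessian makes [dphi] nonpositive
    on [0, 1]. The mean value theorem then gives the factor L / 2 without integration. *)
Lemma grad_taylor a h v :
  dotp (gF (a + h)) v <=
  dotp (gF a) v + dotp (mxv (HF a) h) v + L / 2 * enorm h ^+ 2 * enorm v.
Proof.
pose K := L * enorm h ^+ 2 * enorm v.
pose phi (s : R) := dotp (gF (a + s *: h)) v - s * dotp (mxv (HF a) h) v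
                    - s ^+ 2 * (K / 2).
pose dphi (s : R) := dotp (mxv (HF (a + s *: h) - HF a) h) v - s * K.
have phiD s : is_derive s (1 : R) phi (dphi s).
  have -> : phi = (fun s => dotp (gF (a + s *: h)) v)
     - (dotp (mxv (HF a) h) v \*: (id : R -> R)) - ((K / 2) \*: (id ^+ 2 : R -> R)).
    by apply/funext => t; rewrite /phi /= !fctE; congr (_ - _ - _); rewrite mulrC.
  apply: is_derive_eq; rewrite /dphi !dotpE /GRing.scale /= expr1; by field.
have [s /andP[s0 s1]] := MVT01 phiD.
have -> : phi 0 = dotp (gF a) v by rewrite /phi scale0r addr0 mul0r expr0n /= mul0r !subr0.
have -> : phi 1 = dotp (gF (a + h)) v - dotp (mxv (HF a) h) v - K / 2.
  by rewrite /phi scale1r mul1r expr1n mul1r.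
suff : dphi s <= 0 by rewrite /K; lra.
rewrite /dphi subr_le0; apply: le_trans (dotp_mxv_le _ _ _) _.
have := HF_lip (a + s *: h) a; rewrite addrAC subrr add0r enormZ ger0_norm // => hs.
have -> : s * K = L * (s * enorm h) * enorm h * enorm v by rewrite /K; ring.
by rewrite !ler_wpM2r ?enorm_ge0.
Qed.

Lemma grad_taylor_ge a h v :
  dotp (gF a) v + dotp (mxv (HF a) h) v - L / 2 * enorm h ^+ 2 * enorm v <=
  dotp (gF (a + h)) v.
Proof. by have := grad_taylor a h (- v); rewrite !dotpE enormN; lra. Qed.

Lemma hessian_sym z u v : dotp (mxv (HF z) u) v = dotp (mxv (HF z) v) u.
Proof.
(* Both sides are, up to O(t^3), the second difference of F divided by t^2. *)
pose N := enorm u + enorm v.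
have N0 : 0 <= N by rewrite addr_ge0 ?enorm_ge0.
pose Delta a b := F (z + b + a) - F (z + b) - F (z + a) + F z.
have main (t : R) (a b : 'rV[R]_d) : 0 <= t -> enorm a + enorm b <= t * N ->
    `|Delta a b - dotp (mxv (HF z) b) a| <= L * (t * N) ^+ 3.
  move=> t0 ab.
  (* [Delta a b] is [phi 1 - phi 0], so it equals a difference of two gradients paired with [a]; the
     Taylor bounds at [z] compare that with the Hessian. *)
  pose phi (s : R) := F (z + b + s *: a) - F (z + s *: a).
  have phiD s : is_derive s (1 : R) phi
      (dotp (gF (z + b + s *: a)) a - dotp (gF (z + s *: a)) a).
    exact: is_deriveB.
  have [s /andP[s0 s1]] := MVT01 phiD.
  rewrite /phi scale1r scale0r !addr0 -/(Delta a b) => e.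
  have -> : Delta a b = dotp (gF (z + b + s *: a)) a - dotp (gF (z + s *: a)) a.
    by rewrite -e /Delta; ring.
  have a0 := enorm_ge0 a; have b0 := enorm_ge0 b.
  have sa : enorm (s *: a) <= t * N.
    by rewrite enormZ ger0_norm //; apply: le_trans ab; nra.
  have sab : enorm (b + s *: a) <= t * N.
    apply: le_trans (enormD _ _) _; rewrite enormZ ger0_norm //.
    by apply: le_trans ab; nra.
  have aN : enorm a <= t * N by apply: le_trans ab; lra.
  have bnd (c : 'rV[R]_d) : enorm c <= t * N -> L / 2 * enorm c ^+ 2 * enorm a <= L / 2 * (t * N) ^+ 3.
    move=> cN; rewrite -[leLHS]mulrA ler_wpM2l ?divr_ge0 // [leRHS]exprSr.
    rewrite ler_pM ?exprn_ge0 ?enorm_ge0 //.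
    by apply: lerXn2r; rewrite ?nnegrE ?enorm_ge0 ?mulr_ge0.
  have := bnd _ sa; have := bnd _ sab.
  have := grad_taylor z (b + s *: a) a; have := grad_taylor z (s *: a) a.
  have := grad_taylor_ge z (b + s *: a) a; have := grad_taylor_ge z (s *: a) a.
  rewrite !dotpE -(addrA z b).
  set q1 := L / 2 * _ * _; set q2 := L / 2 * _ * _; set q3 := L / 2 * _.
  have -> : L * (t * N) ^+ 3 = q3 + q3 by rewrite /q3; field.
  by move=> *; rewrite ler_norml; apply/andP; split; lra.
(* [Delta] is symmetric in its two increments, so scaling both by s bounds s^2 times the asymmetry
   by O(|s|^3). *)
have step (s : R) : `|s| <= 1 -> 0 <= s * (dotp (mxv (HF z) v) u - dotp (mxv (HF z) u) v)
    + s ^+ 2 * (2 * L * N ^+ 3).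
  move=> _.
  have [->|s0] := eqVneq s 0; first by rewrite !mul0r expr0n mul0r addr0.
  have h1 := main `|s| (s *: u) (s *: v) (normr_ge0 _).
  have h2 := main `|s| (s *: v) (s *: u) (normr_ge0 _).
  move: h1 h2; rewrite !enormZ -!mulrDr [enorm v + _]addrC => /(_ (lexx _)) h1 /(_ (lexx _)) h2.
  have sym : Delta (s *: u) (s *: v) = Delta (s *: v) (s *: u).
    by rewrite /Delta (addrAC z (s *: v)); ring.
  rewrite -sym !dotpE in h2; rewrite !dotpE in h1.
  have sE : `|s| ^+ 2 = s ^+ 2 by rewrite real_normK // num_real.
  have s2 : 0 < s ^+ 2 by rewrite exprn_even_gt0.
  have h3 : `|s * (s * dotp (mxv (HF z) v) u) - s * (s * dotp (mxv (HF z) u) v)|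
     <= s ^+ 2 * (2 * L * N ^+ 3 * `|s|).
    have -> : s ^+ 2 * (2 * L * N ^+ 3 * `|s|) = 2 * (L * (`|s| * N) ^+ 3) by rewrite -sE; ring.
    move: h1 h2; rewrite !ler_norml => /andP[? ?] /andP[? ?]; apply/andP; split; lra.
  have h4 : `|dotp (mxv (HF z) v) u - dotp (mxv (HF z) u) v| <= 2 * L * N ^+ 3 * `|s|.
    rewrite -(ler_pM2l s2) -[X in X * _ <= _](ger0_norm (ltW s2)) -normrM.
    by apply: le_trans h3; rewrite le_eqVlt; apply/orP/or_introl/eqP; congr `|_|; ring.
  have h5 : `|s * (dotp (mxv (HF z) v) u - dotp (mxv (HF z) u) v)| <= s ^+ 2 * (2 * L * N ^+ 3).
    by rewrite normrM -sE expr2 -[leRHS]mulrA ler_wpM2l // mulrC.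
  by move: h5; rewrite ler_norml => /andP[]; lra.
by apply/esym/eqP; rewrite -subr_eq0; apply/eqP; exact: linear_term_eq0 step.
Qed.

Hypothesis F_convex : convex_fun F.

(** Convexity bounds the increment of F over t (v - u) by t (F v - F u). The mean value theorem
    writes it as t times a slope at a nearby point, which differs from the slope at u by at most t
    C. *)
Lemma convex_grad u v : F u + dotp (gF u) (v - u) <= F v.
Proof.
have lineE t : t *: v + (1 - t) *: u = u + t *: (v - u).
  by rewrite scalerBr scalerBl scale1r addrCA.
rewrite -subr_le0; move: (v - u) lineE => h lineE.
pose C := `|dotp (mxv (HF u) h) h| + L / 2 * enorm h ^+ 3.
apply: (@le0_small _ _ C) => t /andP[t0 t1].
have phiD (s : R) : is_derive s (1 : R) (fun s => F (u + s *: (t *: h)))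
    (dotp (gF (u + s *: (t *: h))) (t *: h)) by exact: F_derive.
have [s /andP[s0 s1]] := MVT01 phiD.
rewrite scale1r scale0r addr0 scalerA dotpZr => e.
have := F_convex v u; move=> /(_ t); rewrite (ltW t0) t1 => /(_ isT).
rewrite lineE.
have := grad_taylor_ge u ((s * t) *: h) h.
rewrite !dotpE enormZ; move: e.
set q1 := dotp (gF u) h; set q2 := dotp (mxv _ h) h; set q3 := dotp _ h => e h1 h2.
have h3 : q3 <= F v - F u.
  by rewrite -(ler_pM2l t0); lra.
have st : `|s * t| <= t.
  by rewrite ger0_norm ?mulr_ge0 ?(ltW t0) // ler_piMl // ltW.
have st1 := le_trans st t1.
have h4 : `|s * t * q2| <= t * `|q2| by rewrite normrM ler_wpM2r.
have h5 : L / 2 * (`|s * t| * enorm h) ^+ 2 * enorm h <= t * (L / 2 * enorm h ^+ 3).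
  have -> : L / 2 * (`|s * t| * enorm h) ^+ 2 * enorm h
     = `|s * t| ^+ 2 * (L / 2 * enorm h ^+ 3) by ring.
  rewrite ler_wpM2r ?mulr_ge0 ?divr_ge0 ?exprn_ge0 ?enorm_ge0 //.
  by rewrite expr2; apply: le_trans (ler_piMr _ _) st.
have h6 := ler_norm (- (s * t * q2)); rewrite normrN in h6.
rewrite mulrDr; lra.
Qed.

End SmoothConvex.

(** * Expansion and uniform convexity of the cubed norm *)

Section CubedNorm.
Variables (R : realType) (d : nat).
Implicit Types u v : 'rV[R]_d.

(** An exact remainder, obtained by writing the inner product through the three squared norms. Both
    of its summands are nonnegative. *)
Lemma cubed_enormD u v :
  enorm (u + v) ^+ 3 = enorm u ^+ 3 + 3 * enorm u * dotp u v
    + ((enorm (u + v) - enorm u) ^+ 2 * (enorm (u + v) + enorm u / 2)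
       + 3 / 2 * enorm u * enorm v ^+ 2).
Proof.
have -> : dotp u v = (enorm (u + v) ^+ 2 - enorm u ^+ 2 - enorm v ^+ 2) / 2.
  by rewrite !enorm_sqr !dotpE (dotpC v u); field.
by field.
Qed.

Lemma cubed_enorm_le u v : enorm v <= 1 ->
  enorm (u + v) ^+ 3 <= enorm u ^+ 3 + 3 * enorm u * dotp u v
    + enorm v ^+ 2 * (3 * enorm u + 1).
Proof.
move=> v1; rewrite cubed_enormD lerD2l.
have := enorm_ge0 u; have := enorm_ge0 v; have := enorm_ge0 (u + v).
have := enormD u v; have := enormD (u + v) (- v); rewrite addrK enormN.
set n := enorm (u + v); set m := enorm u; set l := enorm v in v1 *.
move=> h1 h2 n0 l0 m0.
have h3 : (n - m) ^+ 2 <= l ^+ 2.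
  rewrite -[leLHS]real_normK ?num_real //; apply: lerXn2r; rewrite ?nnegrE //.
  by rewrite ler_norml; apply/andP; split; lra.
have h4 : (n - m) ^+ 2 * (n + m / 2) <= l ^+ 2 * (3 / 2 * m + 1).
  by apply: ler_pM => //; rewrite ?sqr_ge0 //; lra.
by have := sqr_ge0 l; nra.
Qed.

Lemma cubed_enorm_uniform u v :
  enorm u ^+ 3 + 3 * enorm u * dotp u v + 2^-1 * enorm v ^+ 3 <=
  enorm (u + v) ^+ 3.
Proof.
rewrite cubed_enormD lerD2l.
have := enorm_ge0 u; have := enorm_ge0 v; have := enorm_ge0 (u + v).
have := enormD (u + v) (- u); rewrite addrAC subrr add0r enormN.
have := enormD u v.
set n := enorm (u + v); set m := enorm u; set l := enorm v.
move=> nl ln n0 l0 m0.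
have [lm|ml] := lerP l (3 * m).
  have : l ^+ 2 * (3 / 2 * m - 2^-1 * l) >= 0 by rewrite mulr_ge0 ?sqr_ge0 //; lra.
  have : (n - m) ^+ 2 * (n + m / 2) >= 0 by rewrite mulr_ge0 ?sqr_ge0 //; lra.
  by rewrite exprSr; lra.
(* For s >= 3m the function s^2 (s - 3m) increases, so l may be replaced by n + m; what remains to
   show is exactly [h2]. *)
have h1 : l ^+ 2 * (l - 3 * m) <= (n + m) ^+ 2 * (n + m - 3 * m).
  apply: ler_pM; rewrite ?sqr_ge0 //; [lra| |lra].
  by apply: lerXn2r; rewrite ?nnegrE ?addr_ge0.
have h2 : 0 <= (n - m) ^+ 3 + 4 * m ^+ 3.
  by rewrite addr_ge0 ?mulr_ge0 ?exprn_ge0 //; lra.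
by rewrite -subr_ge0; rewrite -subr_ge0 in h1; lra.
Qed.

(** Stationarity removes the linear term at y; the quadratic part then contributes exactly a |z -
    y|^2, and the cubic part at least b/2 |z - y|^3 by uniform convexity. *)
Lemma quad_cubic_grow (phi : 'rV[R]_d -> R) (C a b : R) (q x0 y z : 'rV[R]_d) :
  0 <= a -> 0 <= b ->
  (forall u, phi u = C + dotp q (u - x0) + a * enorm (u - x0) ^+ 2
                     + b * enorm (u - x0) ^+ 3) ->
  is_argmin phi y ->
  phi y + a * enorm (z - y) ^+ 2 + b / 2 * enorm (z - y) ^+ 3 <= phi z.
Proof.
move=> a0 b0 phiE ymin; pose p := y - x0.
have pE : y - x0 = p by [].
have uE v : y + v - x0 = p + v by rewrite addrAC.
have zE : z - x0 = p + (z - y) by rewrite /p [RHS]addrC addrA subrK.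
clearbody p; pose l v := dotp q v + 2 * a * dotp p v + 3 * b * enorm p * dotp p v.
have l0 v : enorm v <= 1 -> l v = 0.
  move=> v1.
  apply: (@linear_term_eq0 _ _ (a * enorm v ^+ 2 + b * enorm v ^+ 2 * (3 * enorm p + 1))) => s s1.
  have := ymin (y + s *: v); rewrite !phiE uE pE.
  have sv1 : enorm (s *: v) <= 1 by rewrite enormZ mulr_ile1 ?enorm_ge0.
  have := ler_wpM2l b0 (cubed_enorm_le p sv1).
  rewrite !enorm_sqr !dotpE (dotpC v p) /l; lra.
(* [l] is linear, so vanishing on the unit ball extends to all vectors by scaling. *)
have {}l0 v : l v = 0.
  have n0 := enorm_ge0 v.
  have t0 : (1 + enorm v)^-1 != 0 :> R by rewrite invr_eq0 gt_eqF // ltr_pwDl.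
  apply: (mulfI t0); rewrite mulr0 -(l0 ((1 + enorm v)^-1 *: v)).
    by rewrite /l !dotpE; ring.
  by rewrite enormZ ger0_norm ?invr_ge0 ?addr_ge0 // ler_pdivrMl ?ltr_pwDl // mulr1 lerDr.
have := l0 (z - y); rewrite /l.
have := ler_wpM2l b0 (cubed_enorm_uniform p (z - y)).
rewrite !phiE zE pE; move: (z - y) => v.
rewrite !enorm_sqr !dotpE (dotpC v p); lra.
Qed.

End CubedNorm.

(** * Optimality of the cubic model step *)

Section ModelStep.
Variables (R : realType) (d : nat).
Variables (F : 'rV[R]_d -> R) (gF : 'rV[R]_d -> 'rV[R]_d) (HF H1 : 'rV[R]_d -> 'M[R]_d).
Variables L beta : R.
Hypothesis L_ge0 : 0 <= L.

(** The quadratic form is differentiated without assuming [H1 z] symmetric, hence the average of the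
    two pairings. The factor 2 L is 3 M / 6 for M = 4 L. *)
Lemma cubic_model_stationary z x v : 
  is_argmin (cubic_model F gF H1 beta (4 * L) z) x ->
  dotp (gF z) v + 2^-1 * (dotp (mxv (H1 z) (x - z)) v + dotp (mxv (H1 z) v) (x - z))
  + (3 * beta + 2 * L * enorm (x - z)) * dotp (x - z) v = 0.
Proof.
have [h hE] : exists h, h = x - z by exists (x - z).
rewrite -hE => xmin.
pose l v := dotp (gF z) v + 2^-1 * (dotp (mxv (H1 z) h) v + dotp (mxv (H1 z) v) h)
  + (3 * beta + 2 * L * enorm h) * dotp h v.
have l0 w : enorm w <= 1 -> l w = 0.
  move=> w1.
  apply: (@linear_term_eq0 _ _ (2^-1 * dotp (mxv (H1 z + (3 * beta)%:M) w) w
    + 4 * L / 6 * (enorm w ^+ 2 * (3 * enorm h + 1)))) => s s1.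
  have := xmin (x + s *: w); rewrite /cubic_model (addrAC x) -hE.
  have sw1 : enorm (s *: w) <= 1 by rewrite enormZ mulr_ile1 ?enorm_ge0.
  have L46 : 0 <= 4 * L / 6 by rewrite divr_ge0 ?mulr_ge0.
  have := ler_wpM2l L46 (cubed_enorm_le h sw1).
  rewrite !enorm_sqr !dotpE (dotpC w h) /l; lra.
rewrite -/(l v).
have n0 := enorm_ge0 v.
have t0 : (1 + enorm v)^-1 != 0 :> R by rewrite invr_eq0 gt_eqF // ltr_pwDl.
apply: (mulfI t0); rewrite mulr0 -(l0 ((1 + enorm v)^-1 *: v)).
  by rewrite /l !dotpE; ring.
by rewrite enormZ ger0_norm ?invr_ge0 ?addr_ge0 // ler_pdivrMl ?ltr_pwDl // mulr1 lerDr.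
Qed.

Hypothesis grad_taylor : forall a h v, dotp (gF (a + h)) v <=
  dotp (gF a) v + dotp (mxv (HF a) h) v + L / 2 * enorm h ^+ 2 * enorm v.
Hypothesis hessian_sym : forall z u v, dotp (mxv (HF z) u) v = dotp (mxv (HF z) v) u.
Hypothesis similar : forall z, opnorm (HF z - H1 z) <= beta.

(** Stationarity is tested against v. Symmetry lets the Hessian of F be averaged in the same way, so
    each half of the mismatch with [H1 z] costs beta / 2 times the two norms; Taylor's bound gives
    the L / 2 term. *)
Lemma cubic_step z x v : 
  is_argmin (cubic_model F gF H1 beta (4 * L) z) x ->
  dotp (gF x) v + (3 * beta + 2 * L * enorm (x - z)) * dotp (x - z) v <=
  (beta * enorm (x - z) + L / 2 * enorm (x - z) ^+ 2) * enorm v.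
Proof.
move=> /cubic_model_stationary - /(_ v).
have := grad_taylor z (x - z) v; rewrite addrC subrK.
have sim u w : dotp (mxv (HF z - H1 z) u) w <= beta * enorm u * enorm w.
  apply: le_trans (dotp_mxv_le _ _ _) _.
  by rewrite !ler_wpM2r ?enorm_ge0.
have := sim (x - z) v; have := sim v (x - z).
have := hessian_sym z (x - z) v.
move: (x - z) => h; rewrite !dotpE; lra.
Qed.

End ModelStep.

(** * Decrease obtained from one cubic step *)

Section StepConsequences.
Variables (R : realType) (d : nat) (L beta : R).
Hypotheses (L_ge0 : 0 <= L) (beta_gt0 : 0 < beta).

(* Applied to g = grad F(x+), h = x+ - w, u = z - y_t and a = 3 / (t + 3). *)
Lemma step_gain (g h u : 'rV[R]_d) (a : R) : 0 <= a ->
  (forall v, dotp g v + (3 * beta + 2 * L * enorm h) * dotp h v <=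
     (beta * enorm h + L / 2 * enorm h ^+ 2) * enorm v) ->
  0 <= - dotp g h + a * dotp g u + 8 / 3 * beta * (a * enorm u) ^+ 2
       + 16 / 9 * L * (a * enorm u) ^+ 3.
Proof.
move=> a0 hg.
have r0 := enorm_ge0 h; have G0 := enorm_ge0 g; have s0 := enorm_ge0 u.
(* With this test vector the hypothesis reads N^2 <= e N for N = |g + c h|, hence N <= e <= c r /
   2. *)
have h1 := hg (g + (3 * beta + 2 * L * enorm h) *: h).
have h2 := dotp_ge g u.
set r := enorm h in hg h1 r0; set c := 3 * beta + 2 * L * r in hg h1.
have Lr : 0 <= L * r by rewrite mulr_ge0.
have c0 : 0 < c by rewrite /c; have := beta_gt0; lra.
set e := beta * r + L / 2 * r ^+ 2 in hg h1.
have e0 : 0 <= e by rewrite /e addr_ge0 ?mulr_ge0 ?exprn_ge0 ?divr_ge0 // ltW.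
have e1 : e <= c * r / 2.
  have := mulr_ge0 (ltW beta_gt0) r0; have := mulr_ge0 Lr r0.
  by rewrite /e /c; lra.
pose N := enorm (g + c *: h).
have NE : N ^+ 2 = enorm g ^+ 2 + 2 * c * dotp g h + c ^+ 2 * r ^+ 2.
  by rewrite /N /r !enorm_sqr !dotpE (dotpC h g); ring.
have Ne : N ^+ 2 <= e * N.
  by apply: le_trans h1; rewrite /N enorm_sqr !dotpE (dotpC h g); lra.
have N0 : 0 <= N by exact: enorm_ge0.
have {}Ne : N <= e.
  move: N0; rewrite le_eqVlt => /orP[/eqP <- //|Np].
  by rewrite -(ler_pM2r Np) -expr2.
have NN : N ^+ 2 <= c ^+ 2 * r ^+ 2 / 4.
  have : N ^+ 2 <= (c * r / 2) ^+ 2.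
    apply: lerXn2r; rewrite ?nnegrE ?divr_ge0 ?mulr_ge0 ?(ltW c0) //.
    exact: le_trans Ne e1.
  by rewrite !exprMn; lra.
set G := enorm g in G0 h2 NE *; set S := a * enorm u.
have S0 : 0 <= S by rewrite mulr_ge0.
have h3 : - (G * S) <= a * dotp g u.
  have := ler_wpM2l a0 h2; rewrite /S; lra.
have h4 : G ^+ 2 + 3 / 4 * c ^+ 2 * r ^+ 2 <= 2 * c * (- dotp g h) by lra.
(* Since [c] contains 2 L r, the term c S^2 / 2 produces L r S^2. It is paid for by the r^3
   available in [h9] and by 16/9 S^3. *)
have h5 : 0 <= 3 / 4 * r ^+ 3 + 16 / 9 * S ^+ 3 - r * S ^+ 2.
  have -> : 3 / 4 * r ^+ 3 + 16 / 9 * S ^+ 3 - r * S ^+ 2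
    = 16 / 9 * (S + 3 / 16 * r) * (S - 3 / 8 * r) ^+ 2 + 45 / 64 * r ^+ 3 by field.
  by rewrite addr_ge0 // mulr_ge0 ?sqr_ge0 ?exprn_ge0 ?divr_ge0 // mulr_ge0 ?divr_ge0 // addr_ge0 // mulr_ge0 // divr_ge0.
(* AM-GM: [G S <= G^2/(2c) + c S^2/2] *)
have h6 : 0 <= 2 * c * (- dotp g h - G * S + c / 2 * S ^+ 2 - 3 / 8 * c * r ^+ 2).
  have := sqr_ge0 (G - c * S); lra.
have h7 : 0 <= - dotp g h - G * S + c / 2 * S ^+ 2 - 3 / 8 * c * r ^+ 2.
  by rewrite pmulr_rge0 // in h6; rewrite mulr_gt0.
have h8 : c / 2 * S ^+ 2 = 3 / 2 * beta * S ^+ 2 + L * (r * S ^+ 2) by rewrite /c; field.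
have h9 : 3 / 4 * L * r ^+ 3 <= 3 / 8 * c * r ^+ 2.
  have : 0 <= 9 / 8 * beta * r ^+ 2 by rewrite !mulr_ge0 ?sqr_ge0 // ltW.
  rewrite /c; lra.
have h10 := mulr_ge0 L_ge0 h5.
have h11 : 0 <= beta * S ^+ 2 by rewrite mulr_ge0 ?sqr_ge0 // ltW.
lra.
Qed.

End StepConsequences.

(** * Closed form of the weights, and the scalar estimate for the first step *)

Lemma AseqE (R : realType) n :
  Aseq R n = 6 / ((n%:R + 1) * (n%:R + 2) * (n%:R + 3)).
Proof.
have n0 : 0 <= n%:R :> R by [].
elim: n n0 => [|n IH] n0 /=; first by rewrite !add0r; field.
have n1 : 0 <= n%:R :> R by [].
rewrite IH // -(natr1 n); field.
by do ?[apply/andP; split]; apply: lt0r_neq0; lra.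
Qed.

Lemma Aseq_gt0 (R : realType) n : 0 < Aseq R n.
Proof.
by rewrite AseqE divr_gt0 // !mulr_gt0 // ltr_wpDl.
Qed.

(** Here P = |x_1 - xstar|, r = |x_1 - x_0| and Y = F(x_1) - F(xstar). The first bound on X is the
    step inequality, its inner product written through D, P and r. *)
Lemma first_step_arith (R : realType) (L beta D P r X Y : R) :
  0 <= L -> 0 <= beta -> 0 <= D -> 0 <= P -> 0 <= r ->
  X <= (3 * beta + 2 * L * r) / 2 * (D ^+ 2 - P ^+ 2 - r ^+ 2)
       + (beta * r + L / 2 * r ^+ 2) * P ->
  Y <= X -> Y <= 3 / 4 * X + L / 16 * P ^+ 3 ->
  Y <= L / 3 * D ^+ 3 + 3 / 2 * beta * D ^+ 2.
Proof.
move=> L0 b0 D0 P0 r0 hX Y1 Y2.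
(* [Z] is the coefficient of L in the bound on X; by [hb] the beta part is at most 3/2 beta D^2. *)
pose Z := r * (D ^+ 2 - P ^+ 2 - r ^+ 2) + r ^+ 2 * P / 2.
have hb : 0 <= beta * (3 / 2 * P ^+ 2 + 3 / 2 * r ^+ 2 - r * P).
  by apply: mulr_ge0 => //; have := sqr_ge0 (P - r); have := sqr_ge0 P; have := sqr_ge0 r; lra.
have {}hX : X <= 3 / 2 * beta * D ^+ 2 + L * Z by rewrite /Z; lra.
have D3 : 0 <= D ^+ 3 by exact: exprn_ge0.
have rD2 : 0 <= r * D ^+ 2 by rewrite mulr_ge0 ?sqr_ge0.
have bD : 0 <= beta * D ^+ 2 by rewrite mulr_ge0 ?sqr_ge0.
(* In both cases the maximum over r is attained near r = 3/5 D. *)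
have [hP|hP] := lerP (3 / 5 * D) P.
  (* All three certificates vanish at P = r = 3/5 D. *)
  have e1 : 0 <= r * (P - r / 4 - 9 / 20 * D) ^+ 2 by rewrite mulr_ge0 ?sqr_ge0.
  have e2 : 0 <= r * D * (P - 3 / 5 * D) by rewrite !mulr_ge0 // subr_ge0.
  have e3 : 0 <= (r - 3 / 5 * D) ^+ 2 * (15 / 16 * r + 9 / 10 * D).
    by rewrite mulr_ge0 ?sqr_ge0 // addr_ge0 // mulr_ge0 // divr_ge0.
  have hZ : Z <= D ^+ 3 / 3 by rewrite /Z; lra.
  have := ler_wpM2l L0 hZ; lra.
(* For fixed r, [Z] is largest at P = r / 4; [e2] then bounds the remaining cubic in r. *)
have e1 : 0 <= r * (P - r / 4) ^+ 2 by rewrite mulr_ge0 ?sqr_ge0.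
have e2 : 0 <= (r - 3 / 5 * D) ^+ 2 * (r + 6 / 5 * D).
  by rewrite mulr_ge0 ?sqr_ge0 // addr_ge0 // mulr_ge0 // divr_ge0.
have e3 : P ^+ 3 <= (3 / 5 * D) ^+ 3.
  by apply: lerXn2r; rewrite ?nnegrE ?mulr_ge0 ?divr_ge0 // ltW.
have hZ : 3 / 4 * Z + P ^+ 3 / 16 <= D ^+ 3 / 3 by rewrite /Z; lra.
have := ler_wpM2l L0 hZ; lra.
Qed.

(** * The estimate sequence and the accelerated rate *)

Section Accelerated.
Variables (R : realType) (d : nat).
Variables (F : 'rV[R]_d -> R) (gF : 'rV[R]_d -> 'rV[R]_d) (HF H1 : 'rV[R]_d -> 'M[R]_d).
Variables (L beta : R) (x0 xstar : 'rV[R]_d) (x y w : nat -> 'rV[R]_d).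
Hypotheses (L_ge0 : 0 <= L) (beta_gt0 : 0 < beta).
Hypothesis convex_grad : forall u v, F u + dotp (gF u) (v - u) <= F v.
Hypothesis grad_taylor : forall a h v, dotp (gF (a + h)) v <=
  dotp (gF a) v + dotp (mxv (HF a) h) v + L / 2 * enorm h ^+ 2 * enorm v.
Hypothesis hessian_sym : forall z u v, dotp (mxv (HF z) u) v = dotp (mxv (HF z) v) u.
Hypothesis similar : forall z, opnorm (HF z - H1 z) <= beta.
Hypothesis xstar_min : forall v, F xstar <= F v.
Hypothesis x1_min : is_argmin (cubic_model F gF H1 beta (4 * L) x0) (x 1%N).
Hypothesis y1_min : is_argmin (psi_seq F gF L beta x0 x 0) (y 1%N).
Hypothesis iterates : forall t : nat, (1 <= t)%N ->
  w t = (1 - 3 / (t%:R + 3)) *: x t + (3 / (t%:R + 3)) *: y t /\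
  is_argmin (cubic_model F gF H1 beta (4 * L) (w t)) (x t.+1) /\
  is_argmin (psi_seq F gF L beta x0 x t) (y t.+1).

Let psi := psi_seq F gF L beta x0 x.

(** Minimality and the tangent inequality at xstar + s u make the slope along u nonnegative there; s
    tends to 0, and u is replaced by its opposite. *)
Lemma grad_min_eq0 v : dotp (gF xstar) v = 0.
Proof.
have pos u : 0 <= dotp (gF xstar) u.
  rewrite -oppr_le0.
  apply: (@le0_small _ _ (`|dotp (mxv (HF xstar) u) u| + L / 2 * enorm u ^+ 3)).
  move=> s /andP[s0 s1].
  have := convex_grad (xstar + s *: u) xstar.
  have := xstar_min (xstar + s *: u).
  rewrite opprD addrA subrr add0r dotpNr dotpZr => h1 h2.
  have {h1 h2} : 0 <= s * dotp (gF (xstar + s *: u)) u by lra.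
  rewrite pmulr_rge0 // => h1.
  have := grad_taylor xstar (s *: u) u; rewrite enormZ (ger0_norm (ltW s0)) !dotpE.
  have h2 : s * dotp (mxv (HF xstar) u) u <= s * `|dotp (mxv (HF xstar) u) u|.
    by rewrite ler_pM2l // ler_norm.
  have h3 : s * (s * (L / 2 * enorm u ^+ 3)) <= s * (L / 2 * enorm u ^+ 3).
    by rewrite ler_pM2l // ler_piMl // mulr_ge0 ?exprn_ge0 ?enorm_ge0 ?divr_ge0.
  rewrite mulrDr; lra.
by apply/eqP; rewrite eq_le pos -oppr_ge0 -dotpNr pos.
Qed.

Lemma first_step_gap :
  F (x 1%N) - F xstar <= L / 3 * enorm (x0 - xstar) ^+ 3 + 3 / 2 * beta * enorm (x0 - xstar) ^+ 2.
Proof.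
have step := cubic_step L_ge0 grad_taylor hessian_sym similar (x 1%N - xstar) x1_min.
have c1 := convex_grad (x 1%N) xstar.
(* Midpoint bound: two tangent inequalities lead from x_1 through [mid] to xstar. In the sum of the
   Taylor bounds at [mid] in opposite directions the Hessian cancels, which controls the slope at
   [mid]. *)
pose mid := xstar + 2^-1 *: (x 1%N - xstar).
have c2 := convex_grad (x 1%N) mid.
have c3 := convex_grad mid xstar.
have t1 := grad_taylor mid (2^-1 *: (x 1%N - xstar)) (- (x 1%N - xstar)).
have t2 := grad_taylor mid (- (2^-1 *: (x 1%N - xstar))) (- (x 1%N - xstar)).
have E1 : mid + 2^-1 *: (x 1%N - xstar) = x 1%N.
  by rewrite /mid -addrA -scalerDl (_ : 2^-1 + 2^-1 = 1 :> R) ?scale1r 1?addrC ?subrK //; field.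
have E2 : mid - 2^-1 *: (x 1%N - xstar) = xstar by rewrite /mid addrK.
have E3 : mid - x 1%N = - (2^-1 *: (x 1%N - xstar)) by rewrite -[X in mid - X = _]E1 opprD addrA subrr add0r.
have E4 : xstar - mid = - (2^-1 *: (x 1%N - xstar)) by rewrite /mid opprD addrA subrr add0r.
have E5 : x0 - xstar = (x 1%N - xstar) - (x 1%N - x0).
  by rewrite opprB [RHS]addrC addrA subrK.
have E6 : xstar - x 1%N = - (x 1%N - xstar) by rewrite opprB.
rewrite E3 in c2; rewrite E4 in c3; rewrite E1 in t1; rewrite E2 in t2; rewrite E6 in c1.
clearbody mid.
apply: (@first_step_arith _ L beta _ (enorm (x 1%N - xstar)) (enorm (x 1%N - x0))
  (dotp (gF (x 1%N)) (x 1%N - xstar))); rewrite ?enorm_ge0 ?(ltW beta_gt0) //.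
- rewrite E5; move: step; move: (x 1%N - xstar) (x 1%N - x0) => p h.
  by rewrite ![_ ^+ 2]enorm_sqr !dotpE (dotpC p h); lra.
- by move: c1; rewrite !dotpE; lra.
move: c2 c3 t1 t2; move: (x 1%N - xstar) => p.
have g0 := grad_min_eq0 p.
by rewrite !enormN !enormZ ger0_norm ?invr_ge0 // !dotpE g0; lra.
Qed.

(** [psi n] is psi_(n+1) of the algorithm, so the quadratic coefficient is 8 beta plus n times 4
    beta. *)
Lemma psi_shape n : exists C q, forall z, psi n z = C + dotp q (z - x0)
  + 4 * beta * (n%:R + 2) * enorm (z - x0) ^+ 2 + 16 * L * enorm (z - x0) ^+ 3.
Proof.
elim: n => [|n [C [q IH]]].
  exists (F (x 1%N)), 0 => z; rewrite /psi /= -(scale0r 0) dotpZl; ring.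
pose k := 3 / (Aseq R n.+1 * (n.+1%:R + 3)).
exists (C + k * (F (x n.+2) + dotp (gF (x n.+2)) (x0 - x n.+2))), (q + k *: gF (x n.+2)) => z.
have -> : psi n.+1 z = psi n z + 4 * beta * enorm (z - x0) ^+ 2
   + k * (F (x n.+2) + dotp (gF (x n.+2)) (z - x n.+2)) by [].
rewrite IH -(natr1 n) !dotpE; ring.
Qed.

Lemma psi_grow n z u : is_argmin (psi n) u ->
  psi n u + 4 * beta * (n%:R + 2) * enorm (z - u) ^+ 2 + 8 * L * enorm (z - u) ^+ 3 <= psi n z.
Proof.
have [C [q E]] := psi_shape n.
have b0 := ltW beta_gt0.
have n0 : 0 <= n%:R + 2 :> R by rewrite addr_ge0.
have a0 : 0 <= 4 * beta * (n%:R + 2) by rewrite !mulr_ge0.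
have c0 : 0 <= 16 * L by rewrite mulr_ge0.
move=> /(quad_cubic_grow z a0 c0 E); lra.
Qed.

Lemma psi_argmin n : is_argmin (psi n) (y n.+1).
Proof. by case: n => [//|n]; have [_ []] := iterates (ltn0Sn n). Qed.

Lemma estimate_seq n : F (x n.+1) / Aseq R n <= psi n (y n.+1).
Proof.
elim: n => [|n IH].
  rewrite /psi /= divr1 -addrA lerDl addr_ge0 // !mulr_ge0 ?exprn_ge0 ?enorm_ge0 //.
  exact: ltW.
(* The induction step holds at every point, so the minimizer is generalized. *)
move: (y n.+2) => z.
have [wE [xmin _]] := iterates (ltn0Sn n).
set t := n.+1 in wE xmin *; set a := 3 / (t%:R + 3) in wE.
have A0 := Aseq_gt0 R n; have A1 := Aseq_gt0 R t.
have tn : t%:R = n%:R + 1 :> R by rewrite /t -natr1.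
have n0 : 0 <= n%:R :> R by [].
have t3 : 0 < t%:R + 3 :> R by rewrite ltr_wpDl.
have a0 : 0 <= a by rewrite divr_ge0 // ltW.
have a1 : 0 <= 1 - a by rewrite subr_ge0 ler_pdivrMr // mul1r lerDr.
have gain := step_gain L_ge0 beta_gt0 (z - y t) a0
  (fun v => cubic_step L_ge0 grad_taylor hessian_sym similar v xmin).
have grow := psi_grow z (psi_argmin n).
have cvx := convex_grad (x t.+1) (x t).
have AE : Aseq R t = Aseq R n * (1 - a) by [].
have -> : psi t z = psi n z + 4 * beta * enorm (z - x0) ^+ 2
    + a / Aseq R t * (F (x t.+1) + dotp (gF (x t.+1)) (z - x t.+1)).
  by rewrite /a -[3 / _ / _]mulrA -invfM (mulrC (t%:R + 3)).
have s0 := enorm_ge0 (z - y t).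
(* [b1] and [b2]: the growth of psi around its minimizer absorbs the error terms of [gain] divided
   by A_t, up to ratios at most 1. *)
have b1 : (8 / 3 * beta * (a * enorm (z - y t)) ^+ 2) / Aseq R t <=
    4 * beta * (n%:R + 2) * enorm (z - y t) ^+ 2.
  rewrite AseqE /a tn; set s := enorm _.
  have -> : 8 / 3 * beta * (3 / (n%:R + 1 + 3) * s) ^+ 2 /
     (6 / ((n%:R + 1 + 1) * (n%:R + 1 + 2) * (n%:R + 1 + 3))) =
     4 * beta * (n%:R + 2) * s ^+ 2 * ((n%:R + 3) / (n%:R + 4)).
    by field; do ?[apply/andP; split]; apply: lt0r_neq0; lra.
  rewrite ler_piMr ?mulr_ge0 ?addr_ge0 ?sqr_ge0 ?(ltW beta_gt0) //.
  by rewrite ler_pdivrMr; lra.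
have b2 : (16 / 9 * L * (a * enorm (z - y t)) ^+ 3) / Aseq R t <=
    8 * L * enorm (z - y t) ^+ 3.
  rewrite AseqE /a tn; set s := enorm _.
  have -> : 16 / 9 * L * (3 / (n%:R + 1 + 3) * s) ^+ 3 /
     (6 / ((n%:R + 1 + 1) * (n%:R + 1 + 2) * (n%:R + 1 + 3))) =
     8 * L * s ^+ 3 * ((n%:R + 2) * (n%:R + 3) / (n%:R + 4) ^+ 2).
    by field; do ?[apply/andP; split]; apply: lt0r_neq0; lra.
  rewrite ler_piMr ?mulr_ge0 ?exprn_ge0 //.
  rewrite ler_pdivrMr; first by nra.
  by rewrite exprn_gt0; lra.
have iE : (1 - a) / Aseq R t = (Aseq R n)^-1.
  have a1' : 1 - a != 0 by apply/eqP => e; move: A1; rewrite AE e mulr0 ltxx.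
  by rewrite AE invfM mulrCA divff // mulr1.
have cvx' : (1 - a) / Aseq R t * (F (x t.+1) + dotp (gF (x t.+1)) (x t - x t.+1))
    <= F (x t) / Aseq R n.
  by rewrite iE (mulrC (F (x t))); apply: ler_wpM2l cvx; rewrite invr_ge0 ltW.
have b3 : 0 <= 4 * beta * enorm (z - x0) ^+ 2.
  by rewrite mulr_ge0 ?sqr_ge0 // mulr_ge0 // ltW.
have iA0 : 0 <= (Aseq R t)^-1 by rewrite invr_ge0 ltW.
have := mulr_ge0 iA0 gain.
(* By the choice of w_t, y_t cancels and the slopes towards x_t and z remain, as in [cvx'] and the
   new term of psi. *)
have -> : - dotp (gF (x t.+1)) (x t.+1 - w t) + a * dotp (gF (x t.+1)) (z - y t)
   = (1 - a) * dotp (gF (x t.+1)) (x t - x t.+1) + a * dotp (gF (x t.+1)) (z - x t.+1).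
  by rewrite wE !dotpE; ring.
move: IH grow cvx' b1 b2; rewrite -/t -/psi.
set i := (Aseq R t)^-1; set j := (Aseq R n)^-1; lra.
Qed.

(** Every tangent lies below F, and its weight is 1/A_t - 1/A_(t-1), so the weights telescope.
    F(x_1) is kept for [first_step_gap]. *)
Lemma psi_upper n : psi n xstar <= F (x 1%N) + ((Aseq R n)^-1 - 1) * F xstar
  + 4 * beta * (n%:R + 2) * enorm (x0 - xstar) ^+ 2 + 16 * L * enorm (x0 - xstar) ^+ 3.
Proof.
rewrite enormC; elim: n => [|n IH].
  by rewrite /psi /= invr1; lra.
pose k := 3 / (Aseq R n.+1 * (n.+1%:R + 3)).
have -> : psi n.+1 xstar = psi n xstar + 4 * beta * enorm (xstar - x0) ^+ 2
   + k * (F (x n.+2) + dotp (gF (x n.+2)) (xstar - x n.+2)) by [].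
have A1 := Aseq_gt0 R n.+1; have n3 : 0 < n.+1%:R + 3 :> R by rewrite ltr_wpDl.
have k0 : 0 <= k := divr_ge0 (ler0n _ 3) (ltW (mulr_gt0 A1 n3)).
have h := ler_wpM2l k0 (convex_grad (x n.+2) xstar).
have kE : (Aseq R n.+1)^-1 = (Aseq R n)^-1 + k.
  have n0 : 0 <= n%:R :> R by [].
  rewrite /k !AseqE -(natr1 n); field.
  by do ?[apply/andP; split]; apply: lt0r_neq0; lra.
by rewrite kE -(natr1 n); lra.
Qed.

Lemma accelerated_rate t : (1 <= t)%N -> F (x t) - F xstar <=
  98 * L * enorm (x0 - xstar) ^+ 3 / t%:R ^+ 3
  + 48 * beta * enorm (x0 - xstar) ^+ 2 / t%:R ^+ 2.
Proof.
case: t => [//|n] _.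
have A0 := Aseq_gt0 R n.
have h := le_trans (estimate_seq n) (le_trans (psi_argmin n xstar) (psi_upper n)).
have gap := first_step_gap.
set D := enorm (x0 - xstar) in h gap *.
have D0 : 0 <= D by exact: enorm_ge0.
(* 49/3 is 16 from the prox term plus 1/3 from the first step, which also adds 3/2 beta. *)
have {gap}h : (F (x n.+1) - F xstar) / Aseq R n <=
    (4 * beta * (n%:R + 2) + 3 / 2 * beta) * D ^+ 2 + 49 / 3 * L * D ^+ 3.
  by move: h gap; set i := (Aseq R n)^-1; lra.
rewrite ler_pdivrMr // in h; apply: le_trans h _.
rewrite addrC mulrDl; apply: lerD; rewrite AseqE -(natr1 n); have n0 : 0 <= n%:R :> R by [].
  have -> : 49 / 3 * L * D ^+ 3 * (6 / ((n%:R + 1) * (n%:R + 2) * (n%:R + 3))) =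
     98 * L * D ^+ 3 / (n%:R + 1) ^+ 3 * ((n%:R + 1) ^+ 2 / ((n%:R + 2) * (n%:R + 3))).
    by field; do ?[apply/andP; split]; apply: lt0r_neq0; lra.
  rewrite ler_piMr ?divr_ge0 ?mulr_ge0 ?exprn_ge0 ?addr_ge0 //.
  by rewrite ler_pdivrMr; nra.
(* The factor n/2 + 19/16 is 6 (4 (n + 2) + 3/2) / 48. *)
have -> : (4 * beta * (n%:R + 2) + 3 / 2 * beta) * D ^+ 2
      * (6 / ((n%:R + 1) * (n%:R + 2) * (n%:R + 3))) =
   48 * beta * D ^+ 2 / (n%:R + 1) ^+ 2
      * ((n%:R + 1) * (n%:R / 2 + 19 / 16) / ((n%:R + 2) * (n%:R + 3))).
  by field; do ?[apply/andP; split]; apply: lt0r_neq0; lra.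
rewrite ler_piMr ?divr_ge0 ?mulr_ge0 ?exprn_ge0 ?addr_ge0 ?(ltW beta_gt0) //.
by rewrite ler_pdivrMr; nra.
Qed.

End Accelerated.

(** * Derivatives of the average of the local functions *)

Section FiniteAverage.
Variables (R : realType) (d m : nat).
Variables (f : 'I_m -> 'rV[R]_d -> R) (g : 'I_m -> 'rV[R]_d -> 'rV[R]_d).
Variable H : 'I_m -> 'rV[R]_d -> 'M[R]_d.
Hypothesis f_diff : forall k v, is_diff v (f k) (fun h => dotp (g k v) h).
Hypothesis g_diff : forall k v, is_diff v (g k) (fun h => mxv (H k v) h).

Lemma is_derive_average_line (a b : 'rV[R]_d) (s : R) :
  is_derive s (1 : R) (fun s => m%:R^-1 * \sum_(k < m) f k (a + s *: b))
    (dotp (m%:R^-1 *: \sum_(k < m) g k (a + s *: b)) b).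
Proof.
have -> : (fun s => m%:R^-1 * \sum_(k < m) f k (a + s *: b))
    = m%:R^-1 \*: \sum_(k < m) (fun s => f k (a + s *: b)).
  by apply/funext => t; rewrite /= fct_sumE.
have D k := is_derive_line (f_diff k (a + s *: b)).
apply: (is_derive_eq (is_deriveZ _ (is_derive_sum D))).
rewrite dotpZl; congr (_ * _); rewrite /dotp exchange_big /=.
by apply: eq_bigr => i _; rewrite summxE mulr_suml.
Qed.

Lemma is_derive_average_grad_line (a b v : 'rV[R]_d) (s : R) :
  is_derive s (1 : R) (fun s => dotp (m%:R^-1 *: \sum_(k < m) g k (a + s *: b)) v)
    (dotp (mxv (m%:R^-1 *: \sum_(k < m) H k (a + s *: b)) b) v).
Proof.
apply: is_derive_dotp.
have -> : (fun s => m%:R^-1 *: \sum_(k < m) g k (a + s *: b))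
    = m%:R^-1 \*: \sum_(k < m) (fun s => g k (a + s *: b)).
  by apply/funext => t; rewrite /= fct_sumE.
have D k := is_derive_line (g_diff k (a + s *: b)).
apply: (is_derive_eq (is_deriveZ _ (is_derive_sum D))).
rewrite mxvZl; congr (_ *: _).
by rewrite /mxv mulmx_suml raddf_sum.
Qed.

End FiniteAverage.

Theorem theorem1 (R : realType) (d m : nat) (hm : (0 < m)%N)
  (f : 'I_m -> 'rV[R]_d -> R)          (* local functions f_k *)
  (g : 'I_m -> 'rV[R]_d -> 'rV[R]_d)   (* their gradients *)
  (H : 'I_m -> 'rV[R]_d -> 'M[R]_d)    (* their Hessians *)
  (L beta : R) (x0 xstar : 'rV[R]_d)
  (x y w : nat -> 'rV[R]_d) :
  let FF := fun v => m%:R^-1 * \sum_(k < m) f k v in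
  let gF := fun v => m%:R^-1 *: \sum_(k < m) g k v in
  let HF := fun v => m%:R^-1 *: \sum_(k < m) H k v in
  (* twice continuously differentiable, with gradient g k and Hessian H k *)
  (forall k v, is_diff v (f k) (fun h => dotp (g k v) h)) ->
  (forall k v, is_diff v (g k) (fun h => mxv (H k v) h)) ->
  (forall k, continuous (H k)) ->
  convex_fun FF ->
  (forall v, FF xstar <= FF v) ->
  (forall u v, opnorm (HF u - HF v) <= L * enorm (u - v)) ->
  0 < beta ->
  (forall k v, opnorm (HF v - H k v) <= beta) ->
  (* Algorithm 1 *)
  x 0%N = x0 ->
  is_argmin (cubic_model FF gF (H (Ordinal hm)) beta (4 * L) x0) (x 1%N) ->
  is_argmin (psi_seq FF gF L beta x0 x 0) (y 1%N) ->
  (forall t : nat, (1 <= t)%N ->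
     w t = (1 - 3 / (t%:R + 3)) *: x t + (3 / (t%:R + 3)) *: y t /\
     is_argmin (cubic_model FF gF (H (Ordinal hm)) beta (4 * L) (w t)) (x t.+1) /\
     is_argmin (psi_seq FF gF L beta x0 x t) (y t.+1)) ->
  forall t : nat, (1 <= t)%N ->
    FF (x t) - FF xstar <=
      98 * L * enorm (x0 - xstar) ^+ 3 / t%:R ^+ 3
      + 48 * beta * enorm (x0 - xstar) ^+ 2 / t%:R ^+ 2.
Proof.
move=> FF gF HF f_diff g_diff _ FF_convex xstar_min HF_lip beta0 similar x0E x1_min y1_min iterates.
(* A nonzero vector is needed to deduce 0 <= L from the Lipschitz bound. If there is none, both
   sides of the claim are 0. *)
have [[u u0]|all0] := pselect (exists u : 'rV[R]_d, enorm u != 0); last first.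
  have trivial (u : 'rV[R]_d) : u = 0.
    apply: enorm_eq0; apply/eqP/negPn/negP => u0.
    by apply: all0; exists u.
  move=> t _; rewrite (trivial (x t)) (trivial xstar) (trivial x0) !subrr enorm0.
  by rewrite !expr0n !mulr0 !mul0r addr0.
have L0 : 0 <= L.
  have up : 0 < enorm u by rewrite lt_neqAle eq_sym u0 enorm_ge0.
  rewrite -(pmulr_lge0 _ up).
  by have := HF_lip u 0; rewrite subr0; apply: le_trans; exact: opnorm_ge0.
have FD := is_derive_average_line f_diff.
have gD := is_derive_average_grad_line g_diff.
have hess_sym : forall z u v, dotp (mxv (HF z) u) v = dotp (mxv (HF z) v) u.
  exact: hessian_sym L0 FD gD HF_lip.
have grad_ineq : forall u v, FF u + dotp (gF u) (v - u) <= FF v.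
  exact: convex_grad L0 FD gD HF_lip FF_convex.
exact: (accelerated_rate L0 beta0 grad_ineq (grad_taylor gD HF_lip) hess_sym
  (similar (Ordinal hm)) xstar_min x1_min y1_min iterates).
Qed.
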